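(* Consider the labeled $r$-block model described in the context with constant $\omega$. Define \[\tau=\frac{1}{r(a+b)}\sum_{\ell\in\mathcal{L}}|a\mu(\ell)-b\nu(\ell)|,\qquad \omega_0=1/\tau.\] If $\omega<\omega_0$, then for two randomly chosen nodes $\rho$ and $v$, for all $x,y\in\{1,\dots,r\}$, \[\mathbb{P}(\sigma_\rho=x\mid G,\sigma_v=y)\to\frac1r\] asymptotically almost surely (i.e. with probability tending to one as $n\to\infty$, the conditional probability is $(1+o(1))/r$).
   Context: Model: $n$ nodes with i.i.d. attributes $\sigma_i$ uniform on $\mathcal{X}=\{1,\dots,r\}$, $r\ge2$. For positive constants $a,b$, each pair $i,j$ independently has an edge with probability $\frac{a}{a+b}$ if $\sigma_i=\sigma_j$ and $\frac{b}{a+b}$ otherwise; each edge is independently labeled from a finite label set $\mathcal{L}$ according to a probability measure $\mu$ if $\sigma_i=\sigma_j$ and $\nu$ otherwise ($\mu\ne\nu$); each labeled edge is independently retained with probability $\omega/n$, with $\omega>0$ a constant. $G$ denotes the observed labeled graph (retained edges with their labels). *)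

(* Defs.v *)
From Stdlib Require Import Reals.
From mathcomp Require Import all_boot.
Set Implicit Arguments. Unset Strict Implicit. Unset Printing Implicit Defensive.

Local Open Scope R_scope.

Definition rsum (T : finType) (F : T -> R) : R := \big[Rplus/0]_(t : T) F t.
Definition rsum_if (T : finType) (P : pred T) (F : T -> R) : R :=
  \big[Rplus/0]_(t : T | P t) F t.
Definition rprod (T : finType) (F : T -> R) : R := \big[Rmult/1]_(t : T) F t.

Definition is_prob (L : finType) (m : L -> R) : Prop :=
  (forall l, 0 <= m l) /\ rsum m = 1.

Definition tau (L : finType) (r : nat) (a b : R) (mu nu : L -> R) : R :=
  / (INR r * (a + b)) * rsum (fun l => Rabs (a * mu l - b * nu l)).

Definition labeling (n r : nat) := {ffun 'I_n -> 'I_r}.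
(* observed labeled graph: for each ordered pair (i,j) with i<j,
   None = no retained edge, Some l = retained edge with label l.
   Entries with ~(i<j) are forced to None by the likelihood below. *)
Definition graph (n : nat) (L : finType) := {ffun 'I_n * 'I_n -> option L}.

(* law of the observation on one pair: edge present w.p. a/(a+b) (same
   attribute) or b/(a+b) (different), labelled by mu resp. nu, retained
   w.p. omega/n *)
Definition pair_prob (L : finType) (n : nat) (a b omega : R) (mu nu : L -> R)
  (same : bool) (e : option L) : R :=
  let p := (if same then a / (a + b) else b / (a + b)) * (omega / INR n) in
  match e with
  | None => 1 - p
  | Some l => p * (if same then mu l else nu l)
  end.

Definition lik (L : finType) (n r : nat) (a b omega : R) (mu nu : L -> R)
  (s : labeling n r) (G : graph n L) : R :=
  rprod (fun p : 'I_n * 'I_n =>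
    if (p.1 < p.2)%N then pair_prob n a b omega mu nu (s p.1 == s p.2) (G p)
    else if G p is None then 1 else 0).

Definition joint (L : finType) (n r : nat) (a b omega : R) (mu nu : L -> R)
  (s : labeling n r) (G : graph n L) : R :=
  (/ INR r) ^ n * lik a b omega mu nu s G.

Definition cond_prob (L : finType) (n r : nat) (a b omega : R) (mu nu : L -> R)
  (G : graph n L) (rho v : 'I_n) (x y : 'I_r) : R :=
  rsum_if (fun s : labeling n r => (s rho == x) && (s v == y))
          (fun s => joint a b omega mu nu s G)
  / rsum_if (fun s : labeling n r => s v == y)
          (fun s => joint a b omega mu nu s G).

Definition good_prob (L : finType) (n r : nat) (a b omega : R) (mu nu : L -> R)
  (x y : 'I_r) (eps : R) : R :=
  rsum (fun rho : 'I_n => rsum (fun v : 'I_n =>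
  rsum (fun G : graph n L => rsum (fun s : labeling n r =>
    / INR n * / INR n * joint a b omega mu nu s G *
    (if Rle_dec (Rabs (cond_prob a b omega mu nu G rho v x y - / INR r))
                (eps / INR r) then 1 else 0))))).

(* Main.v *)
(* By total probability it suffices that the law of G hardly changes when the
   colour of one pinned vertex is flipped, few other vertices being pinned and
   the remaining ones uniform. Reveal all edges at the flipped vertex and remove
   it. The edge pattern towards uniform vertices has the same law for both
   colours. Given it, the non-neighbours stay independent with densities
   1 + O(1/n), so a second moment bound makes them uniform again at total
   variation cost O(1/sqrt n). Across an edge labelled l the two conditional laws
   of the neighbour's colour differ by lambda_l (delta_x - delta_x') with
   lambda_l = (a mu(l) - b nu(l)) / (a mu(l) + (r-1) b nu(l)). Changing the
   neighbours one at a time therefore reduces the estimate to a smaller graph in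
   which the neighbours are pinned, with the factor
   E sum_neighbours |lambda_l| <= omega tau < 1. Iterating d times gives
   2 (omega tau)^d + C_d O(1/sqrt n). *)
Require Import Defs.
From Stdlib Require Import Reals.
From mathcomp Require Import all_boot all_order all_algebra ring lra.
From mathcomp Require Import Rstruct.
Set Implicit Arguments. Unset Strict Implicit. Unset Printing Implicit Defensive.

Import Order.TTheory GRing.Theory Num.Theory.

(** * Product measures *)
Section ProductMeasures.
Local Open Scope ring_scope.
Variable R : realFieldType.

Definition pmf (X : finType) (p : X -> R) := (forall x, 0 <= p x) /\ \sum_x p x = 1.

Definition expect (T X : finType) (w : T -> X -> R) (f : {ffun T -> X} -> R) : R :=
  \sum_(u : {ffun T -> X}) (\prod_t w t (u t)) * f u.

Definition splice (T X : finType) (S : pred T) (u g : {ffun T -> X}) : {ffun T -> X} :=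
  [ffun t => if S t then u t else g t].

Section Expect.
Variables T X : finType.
Implicit Types (w : T -> X -> R) (f g : {ffun T -> X} -> R) (u v : {ffun T -> X}).

Lemma eq_expect w1 w2 f g :
  (forall t, w1 t =1 w2 t) -> f =1 g -> expect w1 f = expect w2 g.
Proof.
move=> ew ef; apply: eq_bigr => u _; rewrite ef; congr (_ * _).
by apply: eq_bigr => t _; rewrite ew.
Qed.

Lemma expect_prod w (f : T -> X -> R) :
  expect w (fun u => \prod_t f t (u t)) = \prod_t \sum_x w t x * f t x.
Proof.
by rewrite bigA_distr_bigA; apply: eq_bigr => u _; rewrite big_split.
Qed.

Lemma expect_mass w : (forall t, pmf (w t)) -> expect w (fun=> 1) = 1.
Proof.
move=> wP; transitivity (expect w (fun u => \prod_t (fun _ _ => 1) t (u t))).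
  by apply: eq_expect => // u; rewrite big1.
rewrite (expect_prod w (fun _ _ => 1)) big1 // => t _; rewrite -[RHS](wP t).2.
by apply: eq_bigr => x _; rewrite mulr1.
Qed.

Lemma sum_weight w : (forall t, pmf (w t)) -> \sum_(u : {ffun T -> X}) \prod_t w t (u t) = 1.
Proof.
by move=> wP; rewrite -[RHS](expect_mass wP); apply: eq_bigr => u _; rewrite mulr1.
Qed.

Lemma expectZ w c f : expect w (fun u => c * f u) = c * expect w f.
Proof. by rewrite mulr_sumr; apply: eq_bigr => u _; rewrite mulrCA. Qed.

Lemma expectD w f g : expect w (fun u => f u + g u) = expect w f + expect w g.
Proof. by rewrite -big_split; apply: eq_bigr => u _; rewrite mulrDr. Qed.

Lemma expectB w f g : expect w (fun u => f u - g u) = expect w f - expect w g.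
Proof. by rewrite -sumrB; apply: eq_bigr => u _; rewrite mulrBr. Qed.

Lemma expect_sum w (I : finType) (f : I -> {ffun T -> X} -> R) :
  expect w (fun u => \sum_i f i u) = \sum_i expect w (f i).
Proof. by rewrite exchange_big; apply: eq_bigr => u _; rewrite mulr_sumr. Qed.

Lemma expect_cst w c : (forall t, pmf (w t)) -> expect w (fun=> c) = c.
Proof.
move=> wP; rewrite -[RHS]mulr1 -(expect_mass wP) -expectZ.
by apply: eq_expect => // u; rewrite mulr1.
Qed.

Lemma weight_ge0 w u : (forall t, pmf (w t)) -> 0 <= \prod_t w t (u t).
Proof. by move=> wP; apply: prodr_ge0 => t _; case: (wP t). Qed.

Lemma ler_expect w f g :
  (forall t, pmf (w t)) -> (forall u, f u <= g u) -> expect w f <= expect w g.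
Proof. by move=> wP lefg; apply: ler_sum => u _; apply: ler_wpM2l; rewrite ?weight_ge0. Qed.

Lemma ler_norm_expect w f :
  (forall t, pmf (w t)) -> `|expect w f| <= expect w (fun u => `|f u|).
Proof.
move=> wP; apply: le_trans (ler_norm_sum _ _ _) _; apply: ler_sum => u _.
by rewrite normrM ger0_norm ?weight_ge0.
Qed.

Lemma expect_bound w f b :
  (forall t, pmf (w t)) -> (forall u, `|f u| <= b) -> `|expect w f| <= b.
Proof.
move=> wP fb; apply: le_trans (ler_norm_expect _ wP) _.
by rewrite -[leRHS](expect_cst b wP); apply: ler_expect.
Qed.

(* Exchanging the two coordinate blocks is an involution on pairs [(u, g)] that
   turns [w3 u * w2 g] into [w1 u * w g], where [w] is again a product measure. *)
Lemma expect_splice w1 w2 w3 (S : pred T) f :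
  (forall t, pmf (w2 t)) -> (forall t, pmf (w3 t)) ->
  (forall t, S t -> w3 t =1 w1 t) -> (forall t, ~~ S t -> w2 t =1 w1 t) ->
  expect w1 f = expect w3 (fun u => expect w2 (fun v => f (splice S u v))).
Proof.
move=> w2P w3P e3 e2.
pose w4 t := if S t then w2 t else w3 t.
have w4P t : pmf (w4 t) by rewrite /w4; case: ifP.
transitivity (\sum_(p : {ffun T -> X} * {ffun T -> X})
   (\prod_t w1 t (p.1 t)) * (\prod_t w4 t (p.2 t)) * f p.1).
  rewrite -(pair_bigA _ (fun u g : {ffun T -> X} => \prod_t w1 t (u t) * \prod_t w4 t (g t) * f u)) /=.
  apply: eq_bigr => u _; rewrite -mulr_suml -mulr_sumr.
  by rewrite sum_weight // mulr1.
pose sw (p : {ffun T -> X} * {ffun T -> X}) := (splice S p.1 p.2, splice S p.2 p.1).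
have swK : involutive sw.
  by case=> u g; rewrite /sw /=; congr (_, _); apply/ffunP => t; rewrite !ffunE; case: (S t).
rewrite (reindex_inj (inv_inj swK)) /=.
rewrite -(pair_bigA _ (fun u g : {ffun T -> X} =>
  \prod_t w1 t (splice S u g t) * \prod_t w4 t (splice S g u t) * f (splice S u g))) /=.
apply: eq_bigr => u _; rewrite mulr_sumr; apply: eq_bigr => g _.
rewrite mulrA; congr (_ * _); rewrite -!big_split; apply: eq_bigr => t _ /=.
rewrite !ffunE /w4; case: ifP => St; first by rewrite e3.
by rewrite mulrC e2 ?St.
Qed.

Lemma expect_coord w t (h : X -> R) :
  (forall t, pmf (w t)) -> expect w (fun u => h (u t)) = \sum_x w t x * h x.
Proof.
move=> wP.
transitivity (expect w (fun u => \prod_i (fun i x => if i == t then h x else 1) i (u i))).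
  by apply: eq_expect => // u; rewrite (bigD1 t) //= eqxx big1 ?mulr1 // => i /negbTE ->.
rewrite (expect_prod w (fun i x => if i == t then h x else 1)) (bigD1 t) //= eqxx.
rewrite [X in _ * X]big1 ?mulr1 // => i /negbTE ->.
by rewrite -[RHS](wP i).2; apply: eq_bigr => x _; rewrite mulr1.
Qed.

Lemma expect_coord2 w s t (h k : X -> R) : s != t ->
  (forall t, pmf (w t)) ->
  expect w (fun u => h (u s) * k (u t)) = (\sum_x w s x * h x) * (\sum_x w t x * k x).
Proof.
move=> st wP; have ts : t != s by rewrite eq_sym.
transitivity (expect w (fun u =>
   \prod_i (fun i x => if i == s then h x else if i == t then k x else 1) i (u i))).
  apply: eq_expect => // u; rewrite (bigD1 s) //= (bigD1 t) //= eqxx eqxx (negbTE ts).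
  by rewrite big1 ?mulr1 // => i /andP[/negbTE -> /negbTE ->].
rewrite (expect_prod w (fun i x => if i == s then h x else if i == t then k x else 1)).
rewrite (bigD1 s) //= (bigD1 t) //= eqxx eqxx (negbTE ts).
rewrite [X in _ * (_ * X)]big1 ?mulr1 // => i /andP[/negbTE -> /negbTE ->].
by rewrite -[RHS](wP i).2; apply: eq_bigr => x _; rewrite mulr1.
Qed.

(** Isolates coordinate [j]: splicing along all the other coordinates leaves an inner average over
    [w2 j] alone, so two product measures that differ only at [j] can be compared. *)
Lemma expect_upd w1 w2 j f :
  (forall t, pmf (w1 t)) -> (forall t, pmf (w2 t)) -> (forall t, t != j -> w1 t =1 w2 t) ->
  expect w2 f = expect w1 (fun u =>
    \sum_x w2 j x * f [ffun t => if t == j then x else u t]).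
Proof.
move=> w1P w2P e12.
rewrite (@expect_splice w2 w2 w1 (fun t => t != j)) //.
apply: eq_expect => // u; rewrite -(@expect_coord w2 j
  (fun x => f [ffun t => if t == j then x else u t])) //.
apply: eq_expect => // g; congr f; apply/ffunP => t; rewrite !ffunE.
by case: eqVneq => // ->.
Qed.

(** Hybrid argument: the laws are exchanged one coordinate at a time, and each exchange costs at
    most [D t] times the oscillation bound [b]. The hypothesis on [D] is total variation in dual
    form, tested only on functions of oscillation at most [b]. *)
Lemma expect_tensor_dist w1 w2 (D : T -> R) b f :
  (forall t, pmf (w1 t)) -> (forall t, pmf (w2 t)) ->
  (forall t, 0 <= D t) -> 0 <= b ->
  (forall j u u', (forall i, i != j -> u i = u' i) -> `|f u - f u'| <= b) ->
  (forall t (F : X -> R), (forall x y, `|F x - F y| <= b) ->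
     `|\sum_x (w1 t x - w2 t x) * F x| <= D t * b) ->
  `|expect w1 f - expect w2 f| <= (\sum_t D t) * b.
Proof.
move=> w1P w2P D0 b0 fosc Dtv.
(* The hybrid measure: coordinates listed in [s] already carry their new law. A repeated coordinate
   changes nothing and costs zero. *)
pose w (s : seq T) t := if t \in s then w2 t else w1 t.
have wP s t : pmf (w s t) by rewrite /w; case: ifP.
suff H s : `|expect w1 f - expect (w s) f| <= (\sum_(t <- s) D t) * b.
  rewrite -big_enum /= (_ : expect w2 f = expect (w (enum T)) f); first exact: H.
  by apply: eq_expect => // t x; rewrite /w mem_enum.
elim: s => [|j s IH].
  by rewrite big_nil mul0r (_ : expect (w [::]) f = expect w1 f) ?subrr ?normr0 //; exact: eq_expect.
rewrite big_cons mulrDl [leRHS]addrC.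
apply: le_trans (ler_distD (expect (w s) f) _ _) _; apply: lerD => //.
rewrite (@expect_upd (w s) (w s) j) // (@expect_upd (w s) (w (j :: s)) j) //; last first.
  by move=> t tj x; rewrite /w inE (negbTE tj).
rewrite -expectB; apply: expect_bound => // u; rewrite -sumrB.
under eq_bigr do rewrite -mulrBl.
rewrite /w inE eqxx /=; case: ifP => _.
  by rewrite big1 ?normr0 ?mulr_ge0 // => x _; rewrite subrr mul0r.
apply: Dtv => x y; by apply: (fosc j) => i ij; rewrite !ffunE (negbTE ij).
Qed.

(** A substitute for Cauchy-Schwarz without square roots: it integrates
    [2 * a * |f| <= f ^+ 2 + a ^+ 2], and [a] is tuned by the caller. *)
Lemma expect_norm_le w f a : 0 < a -> (forall t, pmf (w t)) ->
  expect w (fun u => `|f u|) <= (expect w (fun u => f u ^+ 2) * a^-1 + a) / 2.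
Proof.
move=> a0 wP.
have -> : (expect w (fun u => f u ^+ 2) * a^-1 + a) / 2 =
    expect w (fun u => 2^-1 * (a^-1 * f u ^+ 2 + a)).
  by rewrite expectZ expectD expectZ expect_cst // mulrC (mulrC a^-1).
apply: ler_expect => // u.
have := sqr_ge0 (`|f u| - a); rewrite sqrrB real_normK ?num_real // => H.
have aN : a != 0 by rewrite gt_eqF.
rewrite -(ler_pM2r a0) (_ : _ * _ * a = (f u ^+ 2 + a ^+ 2) / 2); last by field.
by rewrite ler_pdivlMr //; lra.
Qed.

End Expect.

(** Marginals of a product measure. The configurations with a given pullback form a product set, so
    their weight factorises, and each coordinate outside the image of [sg] sums to one. *)
Lemma expect_pullback (T J X : finType) (sg : J -> T) (w : T -> X -> R) f :
  injective sg -> (forall t, pmf (w t)) ->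
  expect w (fun u => f [ffun j => u (sg j)]) = expect (fun j => w (sg j)) f.
Proof.
move=> sgI wP.
rewrite {1}/expect (partition_big (fun u : {ffun T -> X} => [ffun j => u (sg j)]) xpredT) //=.
apply: eq_bigr => e _; rewrite (eq_bigr (fun u : {ffun T -> X} => \prod_t w t (u t) * f e)); last first.
  by move=> u /eqP ->.
rewrite -mulr_suml; congr (_ * _).
pose Q t x := [forall j, (sg j == t) ==> (x == e j)].
transitivity (\prod_t \sum_(x | Q t x) w t x).
  rewrite bigA_distr_big_dep; apply: eq_bigl => u; apply/eqP/familyP => [ue t|ue].
    by apply/forallP => j; apply/implyP => /eqP <-; rewrite -ue ffunE.
  apply/ffunP => j; rewrite ffunE; apply/eqP.
  by have /forallP/(_ j) := ue (sg j); rewrite eqxx.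
rewrite (bigID (mem (codom sg))) /= [X in _ * X]big1 ?mulr1; last first.
  move=> t tN; rewrite -[RHS](wP t).2; apply: eq_bigl => x.
  by apply/forallP => j; apply/implyP => /eqP tj; rewrite -tj codom_f in tN.
rewrite (eq_bigl (mem [set sg j | j in [set: J]])); last first.
  move=> t; apply/codomP/imsetP => [[j ->]|[j _ ->]]; by exists j.
rewrite big_imset /=; last by move=> ? ? _ _; exact: sgI.
apply: eq_big => [j|j _]; first by rewrite inE.
rewrite (big_pred1 (e j)) // => x; apply/forallP/eqP => [/(_ j)|-> i].
  by rewrite eqxx => /eqP.
by apply/implyP => /eqP/sgI ->.
Qed.

Definition override (T J X : finType) (sg : J -> T) (e : {ffun J -> X}) (g : {ffun T -> X}) :=
  [ffun t => if [pick j | sg j == t] is Some j then e j else g t].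

(** The slots in the image of [sg] are independent of the rest and may be drawn first. On the image
    [w2] is free, since its values there are overwritten; this is what lets a vertex be removed from
    the remaining graph. *)
Lemma expect_override (T J X : finType) (sg : J -> T) (w1 w2 : T -> X -> R) f :
  injective sg -> (forall t, pmf (w1 t)) -> (forall t, pmf (w2 t)) ->
  (forall t, t \notin codom sg -> w2 t =1 w1 t) ->
  expect w1 f = expect (fun j => w1 (sg j)) (fun e => expect w2 (fun g => f (override sg e g))).
Proof.
move=> sgI w1P w2P e12.
rewrite -(@expect_pullback _ _ _ sg w1 (fun e => expect w2 (fun g => f (override sg e g)))) //.
rewrite (@expect_splice _ _ w1 w2 w1 (fun t => t \in codom sg)) //.
apply: eq_expect => // u; apply: eq_expect => // g; congr f; apply/ffunP => t.
rewrite !ffunE; case: pickP => [j /eqP <-|tN]; first by rewrite codom_f ffunE.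
by case: codomP => // -[j tj]; have := tN j; rewrite tj eqxx.
Qed.

End ProductMeasures.

(** * The observation on one pair *)
Section PairKernel.
Local Open Scope ring_scope.
Variables (R : realFieldType) (L K : finType) (c : bool -> L -> R) (h M : R).
Hypothesis c_ge0 : forall s l, 0 <= c s l.
Hypothesis c_sum : forall s, \sum_l c s l <= M.
Hypothesis h_gt0 : 0 < h.
Hypothesis Mh : M * h <= 1 / 2.
Hypothesis K_ge2 : (2 <= #|K|)%N.

Local Notation k := (#|K|%:R : R).

Lemma sum_option (F : option L -> R) : \sum_e F e = F None + \sum_l F (Some l).
Proof.
rewrite (bigD1 None) //=; congr (_ + _).
rewrite (reindex_omap Some id) /=; last by case.
by apply: eq_bigl => l; rewrite eqxx.
Qed.

Lemma k_ge2 : 2 <= k. Proof. by rewrite ler_nat. Qed.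

Lemma sum_color (x : K) (g : bool -> R) :
  \sum_y g (x == y) = g true + (k - 1) * g false.
Proof.
rewrite (bigD1 x) //= eqxx; congr (_ + _).
rewrite (eq_bigr (fun=> g false)); last by move=> y; rewrite eq_sym => /negbTE ->.
by rewrite sumr_const cardC1 -[LHS]mulr_natl -subn1 natrB // ltnW.
Qed.

(** Here [h] stands for [1/n] and [c same l] for the rate of retained edges labelled [l], bounded in
    total by [M]. *)
Definition edge_kernel (same : bool) (e : option L) : R :=
  if e is Some l then c same l * h else 1 - (\sum_l c same l) * h.

Definition no_edge (e : option L) : R := (e == None)%:R.

Definition unif (x : K) : R := k^-1.

(* Law of an edge to a vertex of uniform colour: it does not depend on the
   colour of the other end. *)
Definition edge_law (e : option L) : R :=
  (edge_kernel true e + (k - 1) * edge_kernel false e) / k.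

(* Second eigenvalue of the colour channel across an edge (division gives 0
   when the edge label never occurs); [color_law] is then still a law. *)
Definition eigen (e : option L) : R :=
  if e is Some l then (c true l - c false l) / (c true l + (k - 1) * c false l) else 0.

Definition color_law (e : option L) (x y : K) : R :=
  (1 - eigen e) / k + eigen e * (x == y)%:R.

(* The absence of an edge tilts the colour of its end by a factor [1 + O(h)]. *)
Definition density (e : option L) (x y : K) : R :=
  if e is None then edge_kernel (x == y) None / edge_law None else 1.

Lemma M_ge0 : 0 <= M.
Proof. by apply: le_trans (c_sum true); apply: sumr_ge0. Qed.

Lemma csum_ge0 s : 0 <= \sum_l c s l.
Proof. exact: sumr_ge0. Qed.

Lemma edge_kernel_pmf s : pmf (edge_kernel s).
Proof.
split=> [[l|]|]; rewrite /edge_kernel.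
- by rewrite mulr_ge0 // ltW.
- have := c_sum s; have := h_gt0; have := Mh; nra.
- by rewrite sum_option -mulr_suml subrK.
Qed.

Lemma no_edge_pmf : pmf no_edge.
Proof.
by split=> [e|]; rewrite /no_edge ?ler0n // sum_option /= big1 ?addr0.
Qed.

Lemma unif_pmf : pmf unif.
Proof.
have k0 : k != 0 by rewrite gt_eqF // (lt_le_trans _ k_ge2).
split=> [x|]; first by rewrite invr_ge0 ler0n.
by rewrite sumr_const -[LHS]mulr_natr mulVf.
Qed.

Lemma edge_law_pmf : pmf edge_law.
Proof.
have k2 := k_ge2; split=> [e|].
  have [t0 f0] := ((edge_kernel_pmf true).1 e, (edge_kernel_pmf false).1 e).
  by apply: divr_ge0; nra.
rewrite -mulr_suml big_split -mulr_sumr /= (edge_kernel_pmf true).2 (edge_kernel_pmf false).2.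
field; lra.
Qed.

Lemma eigen_den0 l :
  c true l + (k - 1) * c false l = 0 -> c true l = 0 /\ c false l = 0.
Proof.
move=> s0; have [t0 f0] := (c_ge0 true l, c_ge0 false l).
have kf : 0 <= (k - 2) * c false l by rewrite mulr_ge0 // subr_ge0 k_ge2.
by split; apply/eqP; rewrite eq_le; apply/andP; split=> //; lra.
Qed.

(** The two inequalities say that the off-diagonal entry [(1 - eigen) / k] and the diagonal entry
    [(1 + (k - 1) * eigen) / k] of [color_law] are nonnegative. *)
Lemma eigen_bounds l : eigen (Some l) <= 1 /\ - 1 <= (k - 1) * eigen (Some l).
Proof.
have [[k2 t0] f0] := (k_ge2, c_ge0 true l, c_ge0 false l).
rewrite /eigen; have [->|s0] := eqVneq (c true l + (k - 1) * c false l) 0.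
  by rewrite invr0 !mulr0; split; lra.
have sp : 0 < c true l + (k - 1) * c false l by rewrite lt0r s0; nra.
by rewrite mulrA ler_pdivrMr // ler_pdivlMr //; split; nra.
Qed.

Lemma eigen_norm e : `|eigen e| <= 1.
Proof.
case: e => [l|]; last by rewrite normr0.
have k2 := k_ge2; have [] := eigen_bounds l; rewrite ler_norml; nra.
Qed.

Lemma color_law_pmf e x : pmf (color_law e x).
Proof.
have k2 := k_ge2; split=> [y|].
  have kp : 0 < k by lra.
  have [le1 ge] : eigen e <= 1 /\ - 1 <= (k - 1) * eigen e.
    by case: e => [l|]; [exact: eigen_bounds|rewrite /= mulr0; lra].
  rewrite /color_law -[X in _ + X](mulfK (lt0r_neq0 kp)) -mulrDl divr_ge0 ?ler0n //.
  by case: (x == y); rewrite ?(mulr1, mulr0, mul0r); lra.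
rewrite (sum_color x (fun b => (1 - eigen e) / k + eigen e * b%:R)) /=.
field; lra.
Qed.

Lemma color_law_None x y : color_law None x y = unif y.
Proof. by rewrite /color_law /unif /= mul0r subr0 addr0 div1r. Qed.

Lemma edge_law_None_ge : 1 / 2 <= edge_law None.
Proof.
have k2 := k_ge2; have [[[h0 h1] t0] f0] := (h_gt0, Mh, c_sum true, c_sum false).
rewrite /edge_law /edge_kernel ler_pdivlMr; last by lra.
have : (\sum_l c true l) * h <= M * h by rewrite ler_pM2r.
have : (\sum_l c false l) * h <= M * h by rewrite ler_pM2r.
nra.
Qed.

(** Bayes' rule on one pair: drawing the colour [y] and then the edge is drawing the edge and then
    [y] from [color_law]. For a labelled edge this is exact; for a missing edge [color_law] is
    uniform and [density] carries the correction. *)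
Lemma edge_kernel_factor e x y :
  unif y * edge_kernel (x == y) e = edge_law e * (color_law e x y * density e x y).
Proof.
have k2 := k_ge2; have kN : k != 0 by rewrite gt_eqF //; lra.
case: e => [l|]; last first.
  rewrite color_law_None /density mulrCA; congr (_ * _); rewrite mulrC divfK //.
  by have := edge_law_None_ge; move=> ?; apply: lt0r_neq0; lra.
have [t0 f0] := (c_ge0 true l, c_ge0 false l).
rewrite mulr1 /unif /edge_law /color_law /eigen /edge_kernel.
have [s0|s0] := eqVneq (c true l + (k - 1) * c false l) 0.
  have [ct cf] := eigen_den0 s0.
  by rewrite ct cf; case: (x == y); rewrite ?ct ?cf !(mul0r, mulr0, addr0).
case: (x == y) => /=; field; by rewrite kN s0.
Qed.

Lemma density_mean e x : \sum_y color_law e x y * density e x y = 1.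
Proof.
case: e => [l|].
  by rewrite -[RHS](color_law_pmf (Some l) x).2; apply: eq_bigr => y _; rewrite mulr1.
have Z0 : edge_law None != 0 by have := edge_law_None_ge; move=> ?; apply: lt0r_neq0; lra.
apply: (mulfI Z0); rewrite mulr_sumr mulr1.
under eq_bigr do rewrite -edge_kernel_factor.
rewrite -mulr_sumr (sum_color x (fun b => edge_kernel b None)).
by rewrite /edge_law mulrC.
Qed.

(** Pointwise [|density - 1| <= 2 * M * h], the 2 coming from [edge_law None >= 1/2]. As the mean is
    one, the second moment exceeds one only by the variance, which is of order [h ^+ 2]. *)
Lemma density_sqr e x :
  \sum_y color_law e x y * density e x y ^+ 2 <= 1 + 4 * M ^+ 2 * h ^+ 2.
Proof.
have d1 y : (density e x y - 1) ^+ 2 <= 4 * M ^+ 2 * h ^+ 2.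
  have B : `|density e x y - 1| <= 2 * M * h.
    have [M0 h0] := (M_ge0, h_gt0).
    case: e => [l|]; first by rewrite subrr normr0 !mulr_ge0 // ltW.
    have Z2 := edge_law_None_ge; have Zp : 0 < edge_law None by lra.
    have Z0 : edge_law None != 0 by rewrite gt_eqF.
    rewrite /density (_ : _ - 1 = (edge_kernel (x == y) None - edge_law None) / edge_law None); last by field.
    rewrite normrM normfV (gtr0_norm Zp) ler_pdivrMr //.
    have Mhp : 0 <= M * h by rewrite mulr_ge0 // ltW.
    apply: (@le_trans _ _ (M * h)); last by nra.
    have k2 := k_ge2; have kN : k != 0 by rewrite gt_eqF //; lra.
    have T : 0 <= (\sum_l c true l) * h <= M * h.
      by rewrite ler_pM2r // c_sum mulr_ge0 ?csum_ge0 // ltW.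
    have F : 0 <= (\sum_l c false l) * h <= M * h.
      by rewrite ler_pM2r // c_sum mulr_ge0 ?csum_ge0 // ltW.
    have : 0 <= 1 - edge_law None <= M * h.
      rewrite (_ : 1 - _ = ((\sum_l c true l) * h + (k - 1) * ((\sum_l c false l) * h)) / k).
        by rewrite ler_pdivlMr ?mul0r ?ler_pdivrMr; nra.
      by rewrite /edge_law /edge_kernel; field.
    by rewrite ler_norml /edge_kernel; case: (x == y); lra.
  rewrite -real_normK ?num_real // (_ : 4 * _ * _ = (2 * M * h) ^+ 2); last by ring.
  by rewrite lerXn2r // ?nnegrE // (le_trans _ B).
have -> : \sum_y color_law e x y * density e x y ^+ 2 =
    \sum_y color_law e x y * (density e x y - 1) ^+ 2 +
    2 * (\sum_y color_law e x y * density e x y) - \sum_y color_law e x y.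
  by rewrite mulr_sumr -big_split -sumrB; apply: eq_bigr => y _ /=; ring.
rewrite density_mean (color_law_pmf e x).2.
suff S : \sum_y color_law e x y * (density e x y - 1) ^+ 2 <= 4 * M ^+ 2 * h ^+ 2 by lra.
have <- : \sum_y color_law e x y * (4 * M ^+ 2 * h ^+ 2) = 4 * M ^+ 2 * h ^+ 2.
  by rewrite -mulr_suml (color_law_pmf e x).2 mul1r.
apply: ler_sum => y _.
by apply: ler_wpM2l => //; case: (color_law_pmf e x).
Qed.

(** The weight of a label under [edge_law] cancels the denominator of [eigen]; only the difference
    of the two rates survives, and this is where [tau] comes from. *)
Lemma edge_law_eigen :
  \sum_e edge_law e * `|eigen e| = (\sum_l `|c true l - c false l|) / k * h.
Proof.
have k2 := k_ge2; have kN : k != 0 by rewrite gt_eqF //; lra.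
rewrite sum_option normr0 mulr0 add0r !mulr_suml; apply: eq_bigr => l _.
have [t0 f0] := (c_ge0 true l, c_ge0 false l).
rewrite /edge_law /eigen /edge_kernel normrM normfV.
have s_ge0 : 0 <= c true l + (k - 1) * c false l by nra.
rewrite (ger0_norm s_ge0).
have [s0|s0] := eqVneq (c true l + (k - 1) * c false l) 0.
  have [-> ->] := eigen_den0 s0.
  by rewrite subr0 normr0 !(mul0r, mulr0, addr0).
field; by rewrite kN s0.
Qed.

Lemma edge_law_edge : \sum_e edge_law e * (e != None)%:R <= M * h.
Proof.
have k2 := k_ge2; have kp : 0 < k by lra.
rewrite sum_option mulr0 add0r; under eq_bigr do rewrite mulr1.
rewrite /edge_law -mulr_suml ler_pdivrMr // big_split /= -mulr_sumr -!mulr_suml.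
have T : (\sum_l c true l) * h <= M * h by rewrite ler_pM2r.
have F : (\sum_l c false l) * h <= M * h by rewrite ler_pM2r.
nra.
Qed.

(** Passing from [no_edge] to [edge_kernel] moves mass at most [M * h] away from [None]. *)
Lemma edge_kernel_dist s b (F : option L -> R) : 0 <= b ->
  (forall e e', `|F e - F e'| <= b) ->
  `|\sum_e (edge_kernel s e - no_edge e) * F e| <= M * h * b.
Proof.
move=> b0 Fb.
have -> : \sum_e (edge_kernel s e - no_edge e) * F e =
    \sum_l c s l * h * (F (Some l) - F None).
  rewrite sum_option /edge_kernel /no_edge /=.
  under [in RHS]eq_bigr do rewrite mulrBr.
  rewrite sumrB -mulr_suml -mulr_suml addrC; congr (_ + _); last by ring.
  by apply: eq_bigr => l _; rewrite subr0.
apply: le_trans (ler_norm_sum _ _ _) _.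
apply: (@le_trans _ _ (\sum_l c s l * h * b)).
  apply: ler_sum => l _; rewrite normrM ger0_norm; last by rewrite mulr_ge0 // ltW.
  by apply: ler_wpM2l; rewrite ?mulr_ge0 // ltW.
by rewrite -!mulr_suml; apply: ler_wpM2r => //; rewrite ler_pM2r.
Qed.

(** The uniform part of [color_law] is common to [x] and [x']; the difference of the laws is
    [eigen e] times a difference of point masses. *)
Lemma color_law_dist e x x' b (F : K -> R) :
  (forall y y', `|F y - F y'| <= b) ->
  `|\sum_y (color_law e x y - color_law e x' y) * F y| <= `|eigen e| * b.
Proof.
move=> Fb.
have S z : \sum_y (z == y)%:R * F y = F z.
  by rewrite (bigD1 z) //= eqxx mul1r big1 ?addr0 // => y; rewrite eq_sym => /negbTE ->; rewrite mul0r.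
have -> : \sum_y (color_law e x y - color_law e x' y) * F y = eigen e * (F x - F x').
  rewrite -(S x) -(S x') -sumrB mulr_sumr; apply: eq_bigr => y _.
  by rewrite /color_law; ring.
by rewrite normrM; apply: ler_wpM2l.
Qed.

End PairKernel.

(** * Decay of the influence of one colour *)
Section BlockModel.
Local Open Scope ring_scope.
Variables (R : realFieldType) (L K : finType) (c : bool -> L -> R) (h M : R).
Hypothesis c_ge0 : forall s l, 0 <= c s l.
Hypothesis c_sum : forall s, \sum_l c s l <= M.
Hypothesis h_gt0 : 0 < h.
Hypothesis Mh : M * h <= 1 / 2.
Hypothesis K_ge2 : (2 <= #|K|)%N.

Local Notation k := (#|K|%:R : R).

Variable n : nat.
Hypothesis nh : n%:R * h <= 1.
Variable eps : R.
Hypothesis eps_gt0 : 0 < eps.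
Hypothesis eps_le1 : eps <= 1.
Hypothesis h_eps : h <= eps ^+ 2.
Hypothesis MMh : 4 * M ^+ 2 * h <= 1 / 2.

Local Notation V := 'I_n.
Local Notation coloring := {ffun V -> K}.
Local Notation graph := {ffun V * V -> option L}.
Local Notation kernel := (edge_kernel c h).
Local Notation no_edge := (@no_edge R L).
Local Notation unif := (@unif R K).
Local Notation edge_law := (edge_law K c h).
Local Notation color_law := (@color_law R L K c).
Local Notation density := (@density R L K c h).
Local Notation eigen := (@eigen R L K c).
Local Notation pin F t s := (splice (fun i => i \in F) t s).

Implicit Types (A F W : {set V}) (s t : coloring) (phi : graph -> R).

(** Removing a vertex forces all its pairs to [None], so the type of graphs stays the same
    throughout the recursion. *)
Definition pair_law (A : {set V}) (s : coloring) (p : V * V) : option L -> R :=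
  if [&& (p.1 < p.2)%N, p.1 \notin A & p.2 \notin A]
  then kernel (s p.1 == s p.2) else no_edge.

Definition graph_mean A s (phi : graph -> R) := expect (pair_law A s) phi.

(* Vertices in [A] are removed, those in [F] carry the colours given by [t],
   all others have independent uniform colours. *)
Definition pinned_mean (A F : {set V}) (t : coloring) phi :=
  expect (fun=> unif) (fun s => graph_mean A (pin F t s) phi).

(** The value [j = v] goes to the diagonal slot, which is always empty; this keeps the map total and
    injective on all vertices. *)
Definition edge_slot (v j : V) : V * V := if (j < v)%N then (j, v) else (v, j).

Let kernel_pmf := edge_kernel_pmf c_ge0 c_sum h_gt0 Mh.
Let Unif_pmf : pmf unif := unif_pmf R K_ge2.
Let Color_pmf := color_law_pmf c_ge0 K_ge2.
Let No_pmf := no_edge_pmf R L.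
Let Edge_pmf := edge_law_pmf c_ge0 c_sum h_gt0 Mh K_ge2.

Let eps0 : 0 <= eps := ltW eps_gt0.
Let M0 : 0 <= M := M_ge0 c_ge0 c_sum.
Let h0 : 0 <= h := ltW h_gt0.
Let Mh0 : 0 <= M * h := mulr_ge0 M0 h0.

Lemma edge_slot_inj v : injective (edge_slot v).
Proof.
move=> i j; rewrite /edge_slot; case: ifP => iv; case: ifP => jv [] //.
- by move=> iv'; rewrite iv' ltnn in iv.
- by move=> jv'; rewrite jv' ltnn in jv.
Qed.

Lemma pair_law_pmf A s p : pmf (pair_law A s p).
Proof. by rewrite /pair_law; case: ifP. Qed.

Lemma graph_mean_out A s s' phi :
  (forall i, i \notin A -> s i = s' i) -> graph_mean A s phi = graph_mean A s' phi.
Proof.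
move=> es; apply: eq_expect => // p e; rewrite /pair_law.
by case: and3P => // -[_ p1 p2]; rewrite !es.
Qed.

Lemma graph_mean_bound A s phi : (forall G, `|phi G| <= 1) -> `|graph_mean A s phi| <= 1.
Proof. by move=> phi1; apply: expect_bound => // p; exact: pair_law_pmf. Qed.

Lemma pinned_mean_out A F t t' phi :
  (forall i, i \notin A -> t i = t' i) -> pinned_mean A F t phi = pinned_mean A F t' phi.
Proof.
move=> et; apply: eq_expect => // s; apply: graph_mean_out => i iA.
by rewrite !ffunE; case: ifP => // _; exact: et.
Qed.

Lemma pinned_mean_bound A F t phi :
  (forall G, `|phi G| <= 1) -> `|pinned_mean A F t phi| <= 1.
Proof. by move=> phi1; apply: expect_bound => // s; exact: graph_mean_bound. Qed.

Definition reveal_law (W : {set V}) (x : K) (s : coloring) (j : V) : option L -> R :=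
  if j \in W then no_edge else kernel (x == s j).

Lemma reveal_law_pmf W x s j : pmf (reveal_law W x s j).
Proof. by rewrite /reveal_law; case: ifP. Qed.

(** Every ordered pair through [v] is an [edge_slot v], so off these slots the laws with and without
    [v] coincide and [expect_override] applies. *)
Lemma graph_mean_reveal A v s phi : v \notin A ->
  graph_mean A s phi = expect (reveal_law (v |: A) (s v) s)
    (fun e => graph_mean (v |: A) s (fun G => phi (override (edge_slot v) e G))).
Proof.
move=> vA; rewrite /graph_mean.
rewrite (@expect_override _ _ _ _ (edge_slot v) (pair_law A s) (pair_law (v |: A) s));
  try by move=> ?; exact: pair_law_pmf.
- apply: eq_expect => // j e; rewrite /pair_law /reveal_law /edge_slot in_setU1.
  have [jv|jv|jv] /= := ltngtP j v.
  + have /negbTE -> : j != v by apply: contraTneq jv => ->; rewrite ltnn.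
    by rewrite jv vA andbT eq_sym; case: (j \in A).
  + have /negbTE -> : j != v by apply: contraTneq jv => ->; rewrite ltnn.
    by rewrite jv vA; case: (j \in A).
  + by rewrite (ord_inj jv) ltnn !eqxx.
- exact: edge_slot_inj.
move=> p pN e; rewrite /pair_law !inE !negb_or.
case lt12: (p.1 < p.2)%N => //=.
have [p1v|_] /= := eqVneq p.1 v.
  case/codomP: pN; exists p.2; rewrite /edge_slot -p1v.
  by rewrite ltnNge ltnW //=; case: (p).
have [p2v|_] //= := eqVneq p.2 v.
by case/codomP: pN; exists p.1; rewrite /edge_slot -p2v lt12; case: (p).
Qed.

(** In the induction the cross term [2 * m * y ^+ 2] is absorbed by [y], because
    [2 * m * y <= 1]. *)
Lemma bernoulli_upper (y : R) m :
  0 <= y -> m%:R * y <= 1 / 2 -> (1 + y) ^+ m <= 1 + 2 * (m%:R * y).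
Proof.
move=> y0; elim: m => [|m IH]; first by rewrite expr0 mul0r mulr0 addr0.
rewrite -natr1 mulrDl mul1r => my.
have m0 : 0 <= m%:R * y by rewrite mulr_ge0.
have {}IH : (1 + y) ^+ m <= 1 + 2 * (m%:R * y) by apply: IH; lra.
rewrite exprSr; apply: (@le_trans _ _ ((1 + 2 * (m%:R * y)) * (1 + y))).
  by apply: ler_wpM2r => //; lra.
nra.
Qed.

(** * Revealing the edges at one pinned vertex *)

Section Step.
Variables (A F : {set V}) (v : V) (phi : graph -> R).
Hypothesis vA : v \notin A.
Hypothesis vF : v \in F.
Hypothesis phi1 : forall G, `|phi G| <= 1.

Local Notation A' := (v |: A).
Local Notation W := (F :|: A').

Definition phi_on (e : {ffun V -> option L}) G := phi (override (edge_slot v) e G).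

Definition psi t e s := graph_mean A' (pin F t s) (phi_on e).

Lemma psi_bound t e s : `|psi t e s| <= 1.
Proof. by apply: graph_mean_bound => G; exact: phi1. Qed.

(** Edges from [v] to other pinned vertices would betray the colour of [v], so they are suppressed.
    Each exists with probability at most [M * h], and [phi] oscillates by at most 2. *)
Lemma reveal_cost t :
  `|pinned_mean A F t phi -
    expect (fun=> unif) (fun s => expect (reveal_law W (t v) s) (psi t ^~ s))|
  <= #|F|%:R * (M * h) * 2.
Proof.
rewrite -expectB; apply: expect_bound => // s.
rewrite (graph_mean_reveal _ _ vA) ffunE vF.
have -> : #|F|%:R * (M * h) = \sum_j (if j \in F then M * h else 0).
  by rewrite -big_mkcond sumr_const mulr_natl.
apply: expect_tensor_dist => //; try by move=> j; exact: reveal_law_pmf.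
- by move=> j; case: ifP.
- move=> _ u u' _; apply: le_trans (ler_normB _ _) _.
  by have := psi_bound t u s; have := psi_bound t u' s; rewrite /psi; lra.
move=> j f fosc; rewrite /reveal_law !inE ffunE; case: (boolP (j \in F)) => jF /=.
  case: ifP => _; last exact: edge_kernel_dist.
  by rewrite big1 ?normr0 ?mulr_ge0 // => e _; rewrite subrr mul0r.
rewrite mul0r; case: ifP => _; rewrite big1 ?normr0 // => e _; by rewrite subrr mul0r.
Qed.

Definition star_law (j : V) : option L -> R := if j \in W then no_edge else edge_law.

Definition star_color x (e : {ffun V -> option L}) (j : V) : K -> R := color_law (e j) x.

Definition star_density x (e : {ffun V -> option L}) (s : coloring) : R :=
  \prod_j (if j \in W then 1 else density (e j) x (s j)).

Lemma star_law_pmf j : pmf (star_law j).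
Proof. by rewrite /star_law; case: ifP. Qed.

Lemma star_color_pmf x e j : pmf (star_color x e j).
Proof. exact: Color_pmf. Qed.

(** Bayes' rule for the whole star, one vertex at a time. The outer law [star_law] does not depend
    on the colour [x]. On [W] only the empty slot has weight, and there [color_law] is uniform. *)
Lemma reveal_factor x f :
  expect (fun=> unif) (fun s => expect (reveal_law W x s) (f ^~ s)) =
  expect star_law (fun e => expect (star_color x e) (fun s => star_density x e s * f e s)).
Proof.
rewrite /expect; under eq_bigr do rewrite mulr_sumr.
under [RHS]eq_bigr do rewrite mulr_sumr.
rewrite exchange_big; apply: eq_bigr => e _; apply: eq_bigr => s _ /=.
rewrite !mulrA; congr (_ * _); rewrite -!big_split; apply: eq_bigr => j _ /=.
rewrite /reveal_law /star_law /star_color; case: ifP => jW; last first.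
  by rewrite -mulrA; exact: edge_kernel_factor.
rewrite mulr1 /no_edge; case: (e j) => [l|]; first by rewrite mulr0 mul0r.
by rewrite color_law_None mulrC.
Qed.

(** Second moment method: [star_density] has mean one and second moment at most
    [1 + 8 * M ^+ 2 * h]. With [a = eps] in [expect_norm_le] and [h <= eps ^+ 2] the cost is half of
    [8 * M ^+ 2 * eps + eps]. *)
Lemma density_cost x e f : (forall s, `|f s| <= 1) ->
  `|expect (star_color x e) (fun s => star_density x e s * f s) - expect (star_color x e) f|
  <= (4 * M ^+ 2 + 1 / 2) * eps.
Proof.
move=> f1; rewrite -expectB.
have cP := star_color_pmf x e.
apply: le_trans (ler_norm_expect _ cP) _.
apply: (@le_trans _ _ (expect (star_color x e) (fun s => `|star_density x e s - 1|))).
  apply: ler_expect => // s; rewrite -[X in _ - X]mul1r -mulrBl normrM -[leRHS]mulr1.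
  exact: ler_wpM2l.
apply: le_trans (expect_norm_le _ eps_gt0 cP) _.
have mean1 : expect (star_color x e) (star_density x e) = 1.
  rewrite (expect_prod _ (fun j y => if j \in W then 1 else density (e j) x y)).
  apply: big1 => j _; case: (j \in W); last exact: density_mean c_ge0 c_sum h_gt0 Mh K_ge2 _ _.
  by rewrite -[RHS](cP j).2; apply: eq_bigr => y _; rewrite mulr1.
have sqr1 : expect (star_color x e) (fun s => star_density x e s ^+ 2) <= 1 + 8 * M ^+ 2 * h.
  have -> : expect (star_color x e) (fun s => star_density x e s ^+ 2) =
      \prod_j \sum_y star_color x e j y * (if j \in W then 1 else density (e j) x y ^+ 2).
    rewrite -(expect_prod _ (fun j y => if j \in W then 1 else density (e j) x y ^+ 2)).
    apply: eq_expect => // s; rewrite -prodrXl; apply: eq_bigr => j _.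
    by case: ifP => _; rewrite ?expr1n.
  have y0 : 0 <= 4 * M ^+ 2 * h ^+ 2 by rewrite !mulr_ge0 ?sqr_ge0.
  apply: (@le_trans _ _ (\prod_(j : V) (1 + 4 * M ^+ 2 * h ^+ 2))).
    apply: ler_prod => j _; apply/andP; split.
      by apply: sumr_ge0 => y _; case: ifP => _; rewrite mulr_ge0 ?sqr_ge0 ?(cP j).1.
    case: (j \in W); last exact: density_sqr c_ge0 c_sum h_gt0 Mh K_ge2 _ _.
    by under eq_bigr do rewrite mulr1; rewrite (cP j).2 lerDl.
  rewrite prodr_const card_ord.
  (* The [n] factors, each off by order [h ^+ 2], accumulate only to order [h], since
     [n * h <= 1]. *)
  have ny : n%:R * (4 * M ^+ 2 * h ^+ 2) <= 4 * M ^+ 2 * h.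
    rewrite (_ : n%:R * _ = n%:R * h * (4 * M ^+ 2 * h)); last by ring.
    by rewrite -[leRHS]mul1r; apply: ler_wpM2r; rewrite // !mulr_ge0 ?sqr_ge0.
  move: ny; set q := n%:R * _ => ny.
  apply: le_trans (bernoulli_upper y0 _) _; rewrite -/q; have := MMh; lra.
have -> : expect (star_color x e) (fun s => (star_density x e s - 1) ^+ 2) =
    expect (star_color x e) (fun s => star_density x e s ^+ 2) - 1.
  transitivity (expect (star_color x e)
      (fun s => star_density x e s ^+ 2 + ((-2) * star_density x e s + 1))).
    by apply: eq_expect => // s; ring.
  by rewrite !expectD expectZ mean1 expect_cst //; ring.
have : (expect (star_color x e) (fun s => star_density x e s ^+ 2) - 1) * eps^-1
    <= 8 * M ^+ 2 * eps.
  rewrite ler_pdivrMr //; apply: (@le_trans _ _ (8 * M ^+ 2 * h)); first lra.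
  rewrite -[leRHS]mulrA -expr2; apply: ler_wpM2l => //.
  by rewrite mulr_ge0 ?sqr_ge0.
lra.
Qed.

Definition nbrs (e : {ffun V -> option L}) : {set V} := [set j | e j != None].

Definition next_mean t e u := pinned_mean A' (F :|: nbrs e) (pin F t u) (phi_on e).

(** Non-neighbours are uniform under [star_color], so the average splits into the colours of the
    neighbours, now acting as pins, and fresh uniform colours elsewhere. *)
Lemma psi_next x t e :
  expect (star_color x e) (psi t e) = expect (star_color x e) (next_mean t e).
Proof.
rewrite (@expect_splice _ _ _ _ (fun=> unif) (star_color x e) (fun j => j \in nbrs e)) //.
- apply: eq_expect => // u; apply: eq_expect => // s; congr graph_mean.
  apply/ffunP => i; by rewrite !ffunE in_setU; case: (i \in F); case: (i \in nbrs e).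
- by move=> j; exact: star_color_pmf.
move=> j; rewrite inE negbK => /eqP ej y; by rewrite /star_color ej color_law_None.
Qed.

Lemma reveal_step t :
  `|pinned_mean A F t phi -
    expect star_law (fun e => expect (star_color (t v) e) (next_mean t e))|
  <= #|F|%:R * (M * h) * 2 + (4 * M ^+ 2 + 1 / 2) * eps.
Proof.
apply: le_trans (ler_distD
  (expect (fun=> unif) (fun s => expect (reveal_law W (t v) s) (psi t ^~ s))) _ _) _.
apply: lerD; first exact: reveal_cost.
rewrite reveal_factor -expectB; apply: expect_bound => [j|e]; first exact: star_law_pmf.
by rewrite -psi_next; apply: density_cost => s; exact: psi_bound.
Qed.

Lemma star_law_eigen j :
  \sum_e star_law j e * `|eigen e| <= (\sum_l `|c true l - c false l|) / k * h.
Proof.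
rewrite /star_law; case: ifP => _; last by rewrite (edge_law_eigen h c_ge0 K_ge2).
rewrite sum_option normr0 mulr0 add0r big1 => [|l _]; last by rewrite mul0r.
by rewrite !mulr_ge0 ?invr_ge0 ?ler0n //; exact: sumr_ge0.
Qed.

Lemma star_law_edge j : 0 <= \sum_e star_law j e * (e != None)%:R <= M * h.
Proof.
apply/andP; split.
  by apply: sumr_ge0 => e _; rewrite mulr_ge0 ?(star_law_pmf j).1.
rewrite /star_law; case: ifP => _; last exact: edge_law_edge.
rewrite sum_option mulr0 add0r big1 => [|l _]; last by rewrite mul0r.
by [].
Qed.

(** Needed because the error in [pin_stable] grows with the number of pins, so the sum over
    neighbours picks up the squared degree. The diagonal contributes [n * (M * h) <= M], the
    independent pairs at most [M ^+ 2]. *)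
Lemma nbrs_sqr :
  expect star_law (fun e => #|nbrs e|%:R ^+ 2) <= M + M ^+ 2.
Proof.
have -> : expect star_law (fun e => #|nbrs e|%:R ^+ 2) =
    \sum_i \sum_j expect star_law (fun e => (e i != None)%:R * (e j != None)%:R).
  transitivity (expect star_law (fun e =>
      \sum_i \sum_j (e i != None)%:R * (e j != None)%:R)).
    apply: eq_expect => // e.
    have -> : #|nbrs e|%:R = \sum_i (e i != None)%:R :> R.
      by rewrite -sum1_card natr_sum big_mkcond; apply: eq_bigr => i _; rewrite inE; case: ifP.
    by rewrite expr2 mulr_suml; apply: eq_bigr => i _; rewrite mulr_sumr.
  by rewrite expect_sum; apply: eq_bigr => i _; rewrite expect_sum.
apply: (@le_trans _ _ (\sum_(i : V) \sum_(j : V) ((i == j)%:R * (M * h) + (M * h) ^+ 2))).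
  apply: ler_sum => i _; apply: ler_sum => j _; have [<-|ij] := eqVneq i j.
    rewrite mul1r; apply: (@le_trans _ _ (M * h)); last by rewrite lerDl sqr_ge0.
    have /andP[_] := star_law_edge i; apply: le_trans.
    rewrite -(expect_coord i (fun e => (e != None)%:R)); last exact: star_law_pmf.
    apply: ler_expect => [|e]; first exact: star_law_pmf.
    by case: (e i != None); rewrite ?mulr1 ?mulr0.
  rewrite mul0r add0r (expect_coord2 (fun e => (e != None)%:R) (fun e => (e != None)%:R) ij);
    last exact: star_law_pmf.
  have /andP[i0 i1] := star_law_edge i; have /andP[j0 j1] := star_law_edge j.
  by rewrite expr2; apply: ler_pM.
rewrite (eq_bigr (fun=> M * h + n%:R * (M * h) ^+ 2)); last first.
  move=> i _; rewrite big_split /= sumr_const card_ord mulr_natl; congr (_ + _).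
  by rewrite (bigD1 i) //= eqxx mul1r big1 ?addr0 // => j; rewrite eq_sym => /negbTE ->; rewrite mul0r.
rewrite sumr_const card_ord -[leLHS]mulr_natl mulrDr.
have nhM : n%:R * (M * h) <= M.
  by rewrite mulrCA -[leRHS]mulr1; apply: ler_wpM2l.
apply: lerD => //.
rewrite (_ : n%:R * _ = (n%:R * (M * h)) ^+ 2); last by ring.
by rewrite lerXn2r // nnegrE // mulr_ge0.
Qed.

End Step.

(** Bounds the expected sum of [|eigen|] over the edges revealed at a vertex; for the rates of the
    block model it equals [omega * tau]. *)
Definition theta : R := (\sum_l `|c true l - c false l|) / k.
Hypothesis theta_le1 : theta <= 1.

Lemma theta_ge0 : 0 <= theta.
Proof. by rewrite mulr_ge0 ?invr_ge0 ?ler0n //; exact: sumr_ge0. Qed.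

(* Induction invariant of the decay estimate: one application of
   [pin_stable_step], which reveals the star of the flipped vertex,
   multiplies [T] by [theta < 1]. *)
Definition pin_stable (T B : R) := forall A F t t' v phi,
  (forall i, i != v -> t i = t' i) -> (forall G, `|phi G| <= 1) ->
  `|pinned_mean A F t phi - pinned_mean A F t' phi| <= T + B * (1 + #|F|%:R) * eps.

(** Both means are replaced through [reveal_step], which costs [4 * M] for suppressed edges and
    [8 * M ^+ 2 + 1] for the densities. The rest compares colour laws of the neighbours: the old
    pins give [B] and the new ones [(M + M ^+ 2) * B]. *)
Lemma pin_stable_step T B : 0 <= T -> 0 <= B -> pin_stable T B ->
  pin_stable (T * theta) (4 * M + 8 * M ^+ 2 + 1 + (1 + M + M ^+ 2) * B).
Proof.
move=> T0 B0 IH A F t t' v phi tt' phi1.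
set C := 4 * M + 8 * M ^+ 2 + 1 + (1 + M + M ^+ 2) * B.
have C0 : 0 <= C by rewrite !(sqr_ge0, addr_ge0, mulr_ge0).
have f0 : 0 <= #|F|%:R :> R by [].
have rhs0 : 0 <= T * theta + C * (1 + #|F|%:R) * eps.
  apply: addr_ge0; first exact: mulr_ge0 T0 theta_ge0.
  by apply: mulr_ge0 => //; apply: mulr_ge0 => //; apply: addr_ge0.
have [vA|vA] := boolP (v \in A).
  rewrite (@pinned_mean_out A F t t') ?subrr ?normr0 // => i iA.
  by apply: tt'; apply: contraNneq iA => ->.
have [vF|vF] := boolP (v \in F); last first.
  rewrite (_ : pinned_mean A F t phi = pinned_mean A F t' phi) ?subrr ?normr0 //.
  apply: eq_expect => // s; congr graph_mean; apply/ffunP => i; rewrite !ffunE.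
  by case: ifP => // iF; apply: tt'; apply: contraNneq vF => <-.
pose X t := expect (star_law A F v)
  (fun e => expect (star_color (t v) e) (next_mean A F v phi t e)).
have St := reveal_step vA vF phi1 t.
have St' := reveal_step vA vF phi1 t'.
pose S (e : {ffun V -> option L}) := \sum_j `|eigen (e j)|.
have SN e : 0 <= S e <= #|nbrs e|%:R.
  rewrite sumr_ge0 //= -sum1_card natr_sum big_mkcond; apply: ler_sum => j _; rewrite inE.
  case: ifP => [_|/eqP ->]; [exact: eigen_norm|by rewrite normr0].
have XX : `|X t - X t'| <=
    expect (star_law A F v) (fun e => S e * (T + B * (1 + #|F|%:R + #|nbrs e|%:R) * eps)).
  rewrite -expectB; apply: le_trans (ler_norm_expect _ (star_law_pmf A F v)) _.
  apply: ler_expect => [|e]; first exact: star_law_pmf.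
  (* The vertex [v] is now removed, so [next_mean] no longer sees the flip; only the colour laws of
     the neighbours still differ. *)
  have -> : expect (star_color (t' v) e) (next_mean A F v phi t' e) =
            expect (star_color (t' v) e) (next_mean A F v phi t e).
    apply: eq_expect => // u; apply: pinned_mean_out => i; rewrite !inE negb_or => /andP[iv _].
    by rewrite !ffunE; case: ifP => // _; rewrite tt'.
  have b0 : 0 <= T + B * (1 + #|F|%:R + #|nbrs e|%:R) * eps.
    by rewrite !(sqr_ge0, addr_ge0, mulr_ge0).
  (* Neighbour [j] costs [|eigen (e j)|], which vanishes without an edge, times the effect of
     changing one pin among [F :|: nbrs e], bounded by the induction hypothesis. *)
  apply: expect_tensor_dist => //; try by move=> j; exact: star_color_pmf.
  - move=> j u u' uu'; apply: (@le_trans _ _ (T + B * (1 + #|F :|: nbrs e|%:R) * eps)).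
      apply: (IH _ _ _ _ j) => [i ij|G]; last exact: phi1.
      by rewrite !ffunE; case: ifP => // _; apply: uu'.
    rewrite lerD2l; apply: ler_wpM2r => //.
    apply: ler_wpM2l => //; rewrite -addrA lerD2l -natrD ler_nat.
    by rewrite cardsU leq_subr.
  - by move=> j f; exact: color_law_dist.
have ES : expect (star_law A F v) S <= theta.
  rewrite expect_sum; apply: (@le_trans _ _ (\sum_(j : V) theta * h)).
    apply: ler_sum => j _.
    rewrite (@expect_coord _ _ _ _ j (fun e => `|eigen e|)); last exact: star_law_pmf.
    exact: star_law_eigen.
  rewrite sumr_const card_ord -[leLHS]mulr_natl mulrCA -[leRHS]mulr1.
  by apply: ler_wpM2l => //; exact: theta_ge0.
have ESN : expect (star_law A F v) (fun e => S e * #|nbrs e|%:R) <= M + M ^+ 2.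
  apply: le_trans (nbrs_sqr A F v); apply: ler_expect => [|e]; first exact: star_law_pmf.
  by have /andP[_ SNe] := SN e; rewrite expr2; apply: ler_wpM2r.
have XX2 : `|X t - X t'| <= (T + B * (1 + #|F|%:R) * eps) * theta + B * eps * (M + M ^+ 2).
  apply: le_trans XX _.
  have -> : expect (star_law A F v) (fun e => S e * (T + B * (1 + #|F|%:R + #|nbrs e|%:R) * eps)) =
     (T + B * (1 + #|F|%:R) * eps) * expect (star_law A F v) S +
     B * eps * expect (star_law A F v) (fun e => S e * #|nbrs e|%:R).
    by rewrite -!expectZ -expectD; apply: eq_expect => // e; ring.
  apply: lerD; apply: ler_wpM2l => //.
    by rewrite !(sqr_ge0, addr_ge0, mulr_ge0).
  by rewrite mulr_ge0.
have fMh : #|F|%:R * (M * h) <= #|F|%:R * (M * eps).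
  apply: ler_wpM2l => //; apply: ler_wpM2l => //; apply: le_trans h_eps _.
  by rewrite expr2 -[leRHS]mul1r; apply: ler_wpM2r.
have M20 : 0 <= M ^+ 2 by exact: sqr_ge0.
(* The factor [theta] is kept only on [T]; on the error term it is bounded by one. *)
have th : B * (1 + #|F|%:R) * eps * theta <= B * (1 + #|F|%:R) * eps.
  by rewrite -[leRHS]mulr1; apply: ler_wpM2l; rewrite // !mulr_ge0 ?addr_ge0.
have e1 : 0 <= B * eps * (M + M ^+ 2) * #|F|%:R by rewrite !(sqr_ge0, addr_ge0, mulr_ge0).
have e2 : 0 <= (8 * M ^+ 2 + 1) * #|F|%:R * eps by rewrite !(sqr_ge0, addr_ge0, mulr_ge0).
have e3 : 0 <= M * eps by rewrite mulr_ge0.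
have tri : `|pinned_mean A F t phi - pinned_mean A F t' phi| <=
    `|pinned_mean A F t phi - X t| + `|X t - X t'| + `|pinned_mean A F t' phi - X t'|.
  rewrite -addrA; apply: le_trans (ler_distD (X t) _ _) _; rewrite lerD2l.
  by apply: le_trans (ler_distD (X t') _ _) _; rewrite lerD2l distrC.
apply: le_trans tri _; rewrite /C.
move: St St' XX2; rewrite -/(X t) -/(X t').
set x1 := `|_ - X t|; set x2 := `|X t - _|; set x3 := `|_ - X t'|.
set f : R := #|F|%:R in f0 fMh th e1 e2 *; lra.
Qed.

Fixpoint stable_const (d : nat) : R :=
  if d is d'.+1 then 4 * M + 8 * M ^+ 2 + 1 + (1 + M + M ^+ 2) * stable_const d' else 0.

Lemma stable_const_ge0 d : 0 <= stable_const d.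
Proof.
elim: d => //= d IH; have := sqr_ge0 M; have := M0.
by move=> *; rewrite !addr_ge0 ?mulr_ge0 ?addr_ge0.
Qed.

(** The iteration starts from the trivial bound 2 for two means of a function bounded by one. *)
Lemma pin_stable_iter d : pin_stable (2 * theta ^+ d) (stable_const d).
Proof.
elim: d => [|d IH] /=.
  move=> A F t t' v phi _ phi1; rewrite expr0 !mul0r addr0 mulr1.
  apply: le_trans (ler_normB _ _) _.
  have := pinned_mean_bound A F t phi1; have := pinned_mean_bound A F t' phi1; lra.
rewrite exprSr mulrA; apply: pin_stable_step => //.
  by rewrite mulr_ge0 // exprn_ge0 ?theta_ge0.
exact: stable_const_ge0.
Qed.

(** * Posterior of the colour of a vertex *)
Definition graph_weight (s : coloring) (G : graph) : R := \prod_p pair_law set0 s p (G p).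

Definition agree F t s := [forall i in F, s i == t i].

Lemma sum_weight_pinned F t (phi : graph -> R) :
  \sum_G expect (fun=> unif) (fun s => graph_weight (pin F t s) G) * phi G =
  pinned_mean set0 F t phi.
Proof.
transitivity (\sum_G expect (fun=> unif) (fun s => graph_weight (pin F t s) G * phi G)).
  by apply: eq_bigr => G _; rewrite mulrC -expectZ; apply: eq_expect => // s; rewrite mulrC.
by rewrite -expect_sum.
Qed.

(** Duality: the L1 distance of the two graph laws is attained by the sign of their difference, an
    admissible [phi]. *)
Lemma pinned_tv d F t t' v : (forall i, i != v -> t i = t' i) ->
  \sum_G `|expect (fun=> unif) (fun s => graph_weight (pin F t s) G) -
           expect (fun=> unif) (fun s => graph_weight (pin F t' s) G)|
  <= 2 * theta ^+ d + stable_const d * (1 + #|F|%:R) * eps.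
Proof.
move=> tt'; pose dif G := expect (fun=> unif) (fun s => graph_weight (pin F t s) G) -
           expect (fun=> unif) (fun s => graph_weight (pin F t' s) G).
have sg1 G : `|Num.sg (dif G)| <= 1 by rewrite normr_sg lern1 leq_b1.
apply: le_trans (@pin_stable_iter d set0 F t t' v (fun G => Num.sg (dif G)) tt' sg1).
rewrite -!sum_weight_pinned -sumrB; apply: le_trans (ler_norm _).
by apply: ler_sum => G _; rewrite -mulrBl normrEsg mulrC.
Qed.

(** Translates conditioning into pinning: under uniform colours the event [agree F t] has
    probability [k^-1 ^+ #|F|], and given it the other colours stay uniform. *)
Lemma expect_agree F t (f : coloring -> R) :
  expect (fun=> unif) (fun s => (agree F t s)%:R * f s) =
  k^-1 ^+ #|F| * expect (fun=> unif) (fun s => f (pin F t s)).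
Proof.
rewrite (@expect_splice _ _ _ _ (fun=> unif) (fun=> unif) (fun i => i \in F)) //.
have -> : k^-1 ^+ #|F| = expect (fun=> unif) (fun s => (agree F t s)%:R).
  transitivity (expect (fun=> unif) (fun s : coloring =>
      \prod_i (fun i y => ((i \in F) ==> (y == t i))%:R) i (s i))).
    rewrite (expect_prod _ (fun i y => ((i \in F) ==> (y == t i))%:R)) -prodr_const big_mkcond; apply: eq_bigr => i _.
    case: (i \in F) => /=; last first.
      by rewrite -[LHS](Unif_pmf).2; apply: eq_bigr => y _; rewrite mulr1.
    rewrite (bigD1 (t i)) //= eqxx mulr1 big1 ?addr0 // => y /negbTE ->.
    by rewrite mulr0.
  apply: eq_expect => // s /=; case: (boolP (agree F t s)) => [/forallP H|].
    by rewrite big1 // => i _; rewrite H.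
  case/forallPn => i; rewrite negb_imply => /andP[iF it].
  by rewrite (bigD1 i) //= iF (negbTE it) mul0r.
rewrite mulrC -expectZ; apply: eq_expect => // u.
rewrite mulrC -expectZ; apply: eq_expect => // s.
have -> : agree F t (pin F u s) = agree F t u.
  by apply: eq_forallb => i; rewrite ffunE; case: (i \in F).
case: (boolP (agree F t u)) => [/forall_inP H|]; last by rewrite !mul0r.
by congr (_ * f _); apply/ffunP => i; rewrite !ffunE; case: ifP => // /H /eqP.
Qed.

Definition joint_weight (s : coloring) (G : graph) : R := k^-1 ^+ n * graph_weight s G.

Lemma sum_joint (P : pred coloring) G :
  \sum_(s | P s) joint_weight s G = expect (fun=> unif) (fun s => (P s)%:R * graph_weight s G).
Proof.
rewrite big_mkcond; apply: eq_bigr => s _; rewrite prodr_const card_ord.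
by case: (P s); rewrite ?mul1r // mul0r mulr0.
Qed.

Lemma joint_ge0 s G : 0 <= joint_weight s G.
Proof.
rewrite mulr_ge0 ?exprn_ge0 ?invr_ge0 ?ler0n // prodr_ge0 // => p _.
exact: (pair_law_pmf _ _ _).1.
Qed.

Lemma joint_mass : \sum_G \sum_s joint_weight s G = 1.
Proof.
rewrite exchange_big /= -[RHS](@sum_weight R V K (fun=> unif)) //.
apply: eq_bigr => s _; rewrite prodr_const card_ord -mulr_sumr sum_weight ?mulr1 // => p.
exact: pair_law_pmf.
Qed.

(** The probability of the pinned event is bounded by one, and 3 is [1 + #|F|] for at most two
    pins. *)
Lemma agree_tv d F t t' v : (#|F| <= 2)%N -> (forall i, i != v -> t i = t' i) ->
  \sum_G `|\sum_(s | agree F t s) joint_weight s G - \sum_(s | agree F t' s) joint_weight s G|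
  <= 2 * theta ^+ d + stable_const d * 3 * eps.
Proof.
move=> F2 tt'; have kV : 0 <= k^-1 ^+ #|F| <= 1.
  rewrite exprn_ge0 ?invr_ge0 ?ler0n // exprn_ile1 ?invr_ge0 ?ler0n //.
  by have k2 := k_ge2 R K_ge2; rewrite invf_le1; lra.
have /andP[kV0 kV1] := kV.
apply: le_trans (_ : _ <= 2 * theta ^+ d + stable_const d * (1 + #|F|%:R) * eps) _; last first.
  rewrite lerD2l; apply: ler_wpM2r => //; apply: ler_wpM2l; first exact: stable_const_ge0.
  by rewrite (_ : 3 = 1 + 2%:R) ?lerD2l ?ler_nat // -natr1 addrC.
apply: le_trans (pinned_tv d F tt'); apply: ler_sum => G _.
rewrite !sum_joint !expect_agree -mulrBr normrM ger0_norm //.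
by rewrite -[leRHS]mul1r; apply: ler_wpM2r.
Qed.

Lemma color_tv d v y y' :
  \sum_G `|\sum_(s : coloring | s v == y) joint_weight s G -
           \sum_(s : coloring | s v == y') joint_weight s G|
  <= 2 * theta ^+ d + stable_const d * 3 * eps.
Proof.
pose t z : coloring := [ffun i => if i == v then z else y].
have E z : (fun s : coloring => s v == z) =1 agree [set v] (t z).
  move=> s; apply/idP/forall_inP => [sv i /set1P ->|/(_ v)]; first by rewrite ffunE eqxx.
  by rewrite set11 ffunE eqxx => ->.
have tt' i : i != v -> t y i = t y' i by move=> /negbTE iv; rewrite !ffunE iv.
have F2 : (#|[set v]| <= 2)%N by rewrite cards1.
apply: le_trans (agree_tv d F2 tt'); apply: ler_sum => G _.
by rewrite (eq_bigl _ _ (E y)) (eq_bigl _ _ (E y')).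
Qed.

Lemma color2_tv d rho v x z y : rho != v ->
  \sum_G `|\sum_(s : coloring | (s rho == x) && (s v == y)) joint_weight s G -
           \sum_(s : coloring | (s rho == z) && (s v == y)) joint_weight s G|
  <= 2 * theta ^+ d + stable_const d * 3 * eps.
Proof.
move=> rv; have vr : (v == rho) = false by rewrite eq_sym (negbTE rv).
pose t z : coloring := [ffun i => if i == rho then z else y].
have E z' : (fun s : coloring => (s rho == z') && (s v == y)) =1 agree [set rho; v] (t z').
  move=> s; apply/andP/forall_inP => [[srho sv] i /set2P[] ->|H].
  - by rewrite ffunE eqxx.
  - by rewrite ffunE vr.
  by have := H rho (set21 _ _); have := H v (set22 _ _); rewrite !ffunE eqxx vr.
have tt' i : i != rho -> t x i = t z i by move=> /negbTE iv; rewrite !ffunE iv.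
have F2 : (#|[set rho; v]| <= 2)%N by rewrite cards2 rv.
apply: le_trans (agree_tv d F2 tt'); apply: ler_sum => G _.
by rewrite (eq_bigl _ _ (E x)) (eq_bigl _ _ (E z)).
Qed.

(** Markov's inequality bounds the bad graphs weighted by [P1 y], at cost [k / e * eta]. The full
    weight of a graph is the sum of the [k] terms [P1 z], each within [eta] of [P1 y] in L1, whence
    [k * (k / e) + k]. *)
Lemma posterior_close d rho v x y e : rho != v -> 0 < e ->
  1 - (k ^+ 2 / e + k) * (2 * theta ^+ d + stable_const d * 3 * eps) <=
  \sum_G \sum_s joint_weight s G *
    (`|(\sum_(s : coloring | (s rho == x) && (s v == y)) joint_weight s G) /
       (\sum_(s : coloring | s v == y) joint_weight s G) - k^-1| <= e / k)%R%:R.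
Proof.
move=> rv e0.
set eta := 2 * _ + _.
pose P1 z G := \sum_(s : coloring | s v == z) joint_weight s G.
pose P2 z G := \sum_(s : coloring | (s rho == z) && (s v == y)) joint_weight s G.
pose good G := `|P2 x G / P1 y G - k^-1| <= e / k.
have k2 := k_ge2 R K_ge2; have kp : 0 < k by lra.
have kN : k != 0 by rewrite gt_eqF.
have P1_ge0 z G : 0 <= P1 z G by apply: sumr_ge0 => s _; exact: joint_ge0.
have totE G : \sum_s joint_weight s G = \sum_z P1 z G.
  by rewrite (partition_big (fun s : coloring => s v) xpredT).
have P1E G : P1 y G = \sum_z P2 z G.
  rewrite /P1 (partition_big (fun s : coloring => s rho) xpredT) //=.
  by apply: eq_bigr => z _; apply: eq_bigl => s; rewrite andbC.
have bad1 G : P1 y G * (~~ good G)%:R <= k / e * `|P2 x G - k^-1 * P1 y G|.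
  have ke : 0 <= k / e by rewrite divr_ge0 // ltW.
  rewrite /good -ltNge; case: ltP => [bad|_]; last by rewrite mulr0 mulr_ge0.
  (* Where the conditional probability divides by zero, the graph has no weight on the left. *)
  rewrite mulr1; have [P0|P0] := eqVneq (P1 y G) 0; first by rewrite P0 mulr_ge0.
  have Pp : 0 < P1 y G by rewrite lt0r P0 P1_ge0.
  rewrite (_ : P2 x G - _ = P1 y G * (P2 x G / P1 y G - k^-1)); last by field; rewrite kN P0.
  rewrite normrM (gtr0_norm Pp) mulrCA -[leLHS]mulr1; apply: ler_wpM2l => //.
  rewrite -ler_pdivrMl ?divr_gt0 // mulr1 invf_div; exact: ltW.
(* As [P1 y] is the sum of the [P2 z], the deviation is the average over [z] of [P2 x - P2 z], and
   [color2_tv] bounds each term. *)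
have dev : \sum_G `|P2 x G - k^-1 * P1 y G| <= eta.
  apply: (@le_trans _ _ (\sum_G k^-1 * \sum_z `|P2 x G - P2 z G|)).
    apply: ler_sum => G _.
    rewrite (_ : P2 x G - _ = k^-1 * \sum_z (P2 x G - P2 z G)); last first.
      rewrite sumrB -P1E mulrBr; congr (_ - _).
      by rewrite sumr_const -[X in _ * X]mulr_natl mulKf.
    rewrite normrM ger0_norm ?invr_ge0 ?ler0n //; apply: ler_wpM2l; first by rewrite invr_ge0 ler0n.
    exact: ler_norm_sum.
  rewrite -mulr_sumr exchange_big mulrC ler_pdivrMr //.
  apply: (@le_trans _ _ (\sum_(z : K) eta)).
    by apply: ler_sum => z _; apply: color2_tv.
  by rewrite sumr_const -[leLHS]mulr_natr.
have badE : \sum_G (\sum_s joint_weight s G) * (~~ good G)%:R <= (k ^+ 2 / e + k) * eta.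
  apply: (@le_trans _ _ (\sum_G (k * (P1 y G * (~~ good G)%:R) + \sum_z `|P1 z G - P1 y G|))).
    apply: ler_sum => G _; rewrite totE.
    case: (good G) => /=; first by rewrite !mulr0 add0r sumr_ge0.
    rewrite !mulr1 -[X in X * _](_ : \sum_(z : K) 1 = k); last first.
      by rewrite sumr_const.
    rewrite mulr_suml -big_split /=; apply: ler_sum => z _; rewrite mul1r.
    by rewrite -lerBlDl ler_norm.
  rewrite big_split /= -mulr_sumr mulrDl; apply: lerD.
    apply: (@le_trans _ _ (k * (k / e * eta))); last by rewrite mulrA mulrA -expr2.
    apply: ler_wpM2l; first exact: ltW.
    apply: le_trans (ler_sum _ (fun G _ => bad1 G)) _; rewrite -mulr_sumr.
    by apply: ler_wpM2l => //; rewrite divr_ge0 // ltW.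
  rewrite exchange_big; apply: (@le_trans _ _ (\sum_(z : K) eta)).
    by apply: ler_sum => z _; apply: color_tv.
  by rewrite sumr_const -[leLHS]mulr_natl.
rewrite -[X in X - _ <= _]joint_mass lerBlDr.
apply: le_trans (lerD (lexx _) badE).
rewrite -big_split /=; apply: ler_sum => G _; rewrite -mulr_suml -mulrDr -/(P1 y G) -/(P2 x G) -/(good G).
by case: (good G); rewrite ?addr0 ?add0r mulr1.
Qed.

End BlockModel.

(** * Averaging over the two nodes, and transfer to the model as stated *)

Section Conclusion.
Local Open Scope ring_scope.

(** The diagonal, where the bound loses one, is a fraction [1/n] of all pairs. *)
Lemma average_bound (F : realFieldType) n (g : 'I_n -> 'I_n -> F) eta : (0 < n)%N ->
  (forall rho v, 1 - eta - (rho == v)%:R <= g rho v) ->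
  1 - eta - n%:R^-1 <= \sum_rho \sum_v n%:R^-1 * n%:R^-1 * g rho v.
Proof.
move=> n0 gP; have n0' : n%:R != 0 :> F by rewrite pnatr_eq0 -lt0n.
rewrite (_ : 1 - eta - _ =
    \sum_(rho < n) \sum_(v < n) n%:R^-1 * n%:R^-1 * (1 - eta - (rho == v)%:R)); last first.
  rewrite (eq_bigr (fun=> n%:R^-1 * n%:R^-1 * (n%:R * (1 - eta) - 1))).
    by rewrite sumr_const card_ord -[RHS]mulr_natl; field.
  move=> rho _; rewrite -mulr_sumr sumrB sumr_const card_ord -[X in X - _]mulr_natl.
  by rewrite (bigD1 rho) //= eqxx big1 ?addr0 // => v; rewrite eq_sym => /negbTE ->.
apply: ler_sum => rho _; apply: ler_sum => v _; apply: ler_wpM2l => //.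
by rewrite mulr_ge0 ?invr_ge0 ?ler0n.
Qed.

Section Bridge.
Variables (L : finType) (n r : nat) (a b omega : R) (mu nu : L -> R).

(** Chosen so that [edge_kernel] with [h = 1/n] is [pair_prob]. *)
Definition rate (same : bool) (l : L) : R :=
  if same then a / (a + b) * omega * mu l else b / (a + b) * omega * nu l.

Hypothesis muP : is_prob mu.
Hypothesis nuP : is_prob nu.

Lemma rsumE (T : finType) (F : T -> R) : rsum F = \sum_t F t.
Proof. by []. Qed.

Lemma rate_sum same : \sum_l rate same l = (if same then a / (a + b) else b / (a + b)) * omega.
Proof.
have m1 : \sum_l mu l = 1 by case: muP.
have n1 : \sum_l nu l = 1 by case: nuP.
by case: same; rewrite -mulr_sumr ?m1 ?n1 mulr1.
Qed.

Lemma pair_probE same e :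
  pair_prob n a b omega mu nu same e = edge_kernel rate n%:R^-1 same e.
Proof.
rewrite /pair_prob /edge_kernel INRE !RdivE !RplusE.
case: e => [l|]; rewrite ?RminusE !RmultE ?R1E; last by rewrite rate_sum; case: same; ring.
by rewrite /rate; case: same; ring.
Qed.

Lemma jointE (s : labeling n r) G :
  joint a b omega mu nu s G = joint_weight rate n%:R^-1 s G.
Proof.
rewrite /joint /joint_weight RmultE RpowE RinvE INRE card_ord; congr (_ * _).
apply: eq_bigr => p _; rewrite /pair_law !in_set0 !andbT.
by case: ifP => _; [exact: pair_probE|case: (G p)].
Qed.

End Bridge.

End Conclusion.

Local Open Scope R_scope.

Theorem theorem2 (r : nat) (L : finType) (a b omega : R) (mu nu : L -> R) :
  (2 <= r)%N -> 0 < a -> 0 < b -> 0 < omega ->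
  is_prob mu -> is_prob nu -> mu <> nu ->
  omega < / tau r a b mu nu ->
  forall x y : 'I_r, forall eps delta : R, 0 < eps -> 0 < delta ->
  exists N : nat, forall n : nat, (N <= n)%N ->
    1 - delta <= good_prob n a b omega mu nu x y eps.
Proof.
move=> r2 /RltP a0 /RltP b0 /RltP w0 muP nuP _ /RltP wtau x y e delta /RltP e0 /RltP delta0.
rewrite RinvE in wtau; rewrite R0E in a0 b0 w0 e0 delta0.
pose k : R := (#|'I_r|%:R)%R.
have kE : k = (r%:R)%R by rewrite /k card_ord.
have K2 : (2 <= #|'I_r|)%N by rewrite card_ord.
have mu0 l : (0 <= mu l)%R by apply/RleP; case: muP.
have nu0 l : (0 <= nu l)%R by apply/RleP; case: nuP.
have ab0 : (0 < a + b)%R by rewrite addr_gt0.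
pose c := rate a b omega mu nu.
have c0 s l : (0 <= c s l)%R.
  by rewrite /c /rate; case: s; rewrite mulr_ge0 // ltW // mulr_gt0 // divr_gt0.
have cM s : (\sum_l c s l <= omega)%R.
  rewrite rate_sum // -[leRHS]mul1r; apply: ler_wpM2r; first exact: ltW.
  by case: s; rewrite ler_pdivrMr // mul1r ?lerDl ?lerDr ltW.
have thetaE : theta 'I_r c = (omega * tau r a b mu nu)%R.
  rewrite /theta /tau INRE RinvE rsumE !RmultE RplusE card_ord invfM mulrA.
  rewrite [RHS]mulr_sumr mulr_suml; apply: eq_bigr => l _.
  rewrite /c /rate RabsE RminusE !RmultE.
  rewrite (_ : (a / (a + b) * omega * mu l - b / (a + b) * omega * nu l) =
     omega / (a + b) * (a * mu l - b * nu l))%R; last by ring.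
  rewrite normrM ger0_norm; last by rewrite divr_ge0 // ltW.
  by ring.
have th0 : (0 <= theta 'I_r c)%R by exact: theta_ge0.
have th1 : (theta 'I_r c < 1)%R.
  (* If [tau] vanishes then so does [theta], and no inverse of [tau] has to be interpreted. *)
  have [t0|t0] := eqVneq (tau r a b mu nu) 0%R.
    by rewrite thetaE t0 mulr0 ltr01.
  have tp : (0 < tau r a b mu nu)%R.
    by rewrite lt0r t0 -(pmulr_rge0 _ w0) -thetaE.
  by rewrite thetaE -(ltr_pdivlMr _ _ tp) div1r.
pose kap := (k ^+ 2 / e + k)%R.
have kp : (0 < k)%R by rewrite /k ltr0n ltnW.
have kap0 : (0 < kap)%R by rewrite addr_gt0 // divr_gt0 // exprn_gt0.
(* The depth is fixed first, then [ep] depending on it, then [n]. The decay term, the fluctuation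
   term and the diagonal [rho = v] get [delta / 4] each. *)
have [d Hd] : exists d, (kap * (2 * theta 'I_r c ^+ d) <= delta / 4)%R.
  have tabs : Rabs (theta 'I_r c) < 1.
    by apply/RltP; rewrite RabsE ger0_norm.
  have del : 0 < (delta / 4 / (2 * kap))%R.
    by apply/RltP; rewrite !divr_gt0 ?mulr_gt0.
  have [d Hd] := pow_lt_1_zero _ tabs _ del.
  exists d; have /RltP := Hd d (le_n d).
  rewrite RabsE RpowE ger0_norm ?exprn_ge0 // ltr_pdivlMr ?mulr_gt0 // => Hlt.
  rewrite (_ : kap * _ = theta 'I_r c ^+ d * (2 * kap))%R; [exact: ltW|ring].
pose C := stable_const omega d.
have C0 : (0 <= C)%R by exact: (stable_const_ge0 c0 cM).
have q0 : (0 < 3 * kap * (C + 1))%R.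
  by rewrite mulr_gt0 ?ltr_wpDl // mulr_gt0.
(* [C + 1] keeps the denominator positive, as [C] is zero at depth zero; the minimum with one
   secures [eps <= 1]. *)
pose ep : R := Num.min 1%R (delta / 4 / (3 * kap * (C + 1)))%R.
have ep0 : (0 < ep)%R.
  by rewrite lt_min ltr01 !divr_gt0.
have ep1 : (ep <= 1)%R by rewrite ge_min lexx.
have epC : (kap * (C * 3 * ep) <= delta / 4)%R.
  have : (ep <= delta / 4 / (3 * kap * (C + 1)))%R by rewrite ge_min lexx orbT.
  rewrite ler_pdivlMr //.
  apply: le_trans; have : (0 <= kap * ep)%R by rewrite mulr_ge0 // ltW.
  lra.
(* The first four summands yield the four upper bounds on multiples of [1/n] required below; the
   last makes [n] positive. *)
pose S : R := ((ep ^+ 2)^-1 + 2 * omega + 8 * omega ^+ 2 + 4 / delta + 1)%R.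
have [N HN] : exists N : nat, (S <= N%:R)%R.
  by have [N /RltP/ltW HN] := INR_unbounded S; exists N; rewrite -INRE.
exists N => n leNn.
have w20 : (0 <= omega ^+ 2)%R by exact: sqr_ge0.
have ei0 : (0 <= (ep ^+ 2)^-1)%R by rewrite invr_ge0 sqr_ge0.
have di0 : (0 <= 4 / delta)%R by rewrite divr_ge0 // ltW.
have Sn : (S <= n%:R)%R by apply: le_trans HN _; rewrite ler_nat.
have n0 : (0 < n%:R :> R)%R by move: Sn; rewrite /S; lra.
have n0' : (0 < n)%N by move: n0; rewrite ltr0n.
have h0 : (0 < n%:R^-1 :> R)%R by rewrite invr_gt0.
have [Mh hep MMh hd] : [/\ omega * n%:R^-1 <= 1 / 2, n%:R^-1 <= ep ^+ 2,
    4 * omega ^+ 2 * n%:R^-1 <= 1 / 2 & n%:R^-1 <= delta / 4 :> R]%R.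
  split.
  - by rewrite ler_pdivrMr //; move: Sn; rewrite /S; lra.
  - rewrite -[leRHS]invrK lef_pV2 ?posrE ?invr_gt0 ?exprn_gt0 //.
    by move: Sn; rewrite /S; lra.
  - by rewrite ler_pdivrMr //; move: Sn; rewrite /S; lra.
  rewrite -[leRHS]invf_div lef_pV2 ?posrE ?divr_gt0 //.
  by move: Sn; rewrite /S; lra.
have nh : (n%:R * n%:R^-1 <= 1 :> R)%R by rewrite mulfV // gt_eqF.
pose g (rho v : 'I_n) : R := (\sum_(G : graph n L) \sum_(s : labeling n r) joint_weight c n%:R^-1 s G *
    (`|(\sum_(s : labeling n r | (s rho == x) && (s v == y)) joint_weight c n%:R^-1 s G) /
       (\sum_(s : labeling n r | s v == y) joint_weight c n%:R^-1 s G) - k^-1| <= e / k)%R%:R)%R.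
have goodE : good_prob n a b omega mu nu x y e =
    (\sum_rho \sum_v n%:R^-1 * n%:R^-1 * g rho v)%R.
  rewrite /good_prob rsumE; apply: eq_bigr => rho _; rewrite rsumE; apply: eq_bigr => v _.
  rewrite mulr_sumr rsumE; apply: eq_bigr => G _; rewrite mulr_sumr rsumE.
  apply: eq_bigr => s _; rewrite !RmultE !RinvE !INRE -[LHS]mulrA.
  congr (_ * (_ * _))%R; first exact: jointE.
  have -> : cond_prob a b omega mu nu G rho v x y =
      ((\sum_(s : labeling n r | (s rho == x) && (s v == y)) joint_weight c n%:R^-1 s G) /
       (\sum_(s : labeling n r | s v == y) joint_weight c n%:R^-1 s G))%R.
    rewrite /cond_prob RdivE; congr (_ / _)%R; apply: eq_bigr => s' _; exact: jointE.
  rewrite RminusE RabsE RdivE -kE.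
  by case: Rle_dec => H; move/RleP: (H) => H'; [rewrite H'|rewrite (negbTE H')].
apply/RleP; rewrite goodE.
(* On the diagonal the left side is negative, so nonnegativity of [g] suffices. *)
have gP rho v : (1 - delta / 2 - (rho == v)%:R <= g rho v)%R.
  have [->|rv] := eqVneq rho v.
    apply: (@le_trans _ _ 0%R); first by rewrite /=; lra.
    by apply: sumr_ge0 => G _; apply: sumr_ge0 => s _; rewrite mulr_ge0 // (joint_ge0 c0 cM).
  have := posterior_close c0 cM h0 Mh K2 nh ep0 ep1 hep MMh (ltW th1) d x y rv e0.
  rewrite subr0; apply: le_trans; rewrite lerD2l lerN2 -/k -/kap -/C mulrDr.
  by lra.
have := average_bound n0' gP; apply: le_trans; rewrite RminusE R1E; lra.
Qed.
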